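(* Let $k$ be even and let $G=G_0(u)\diamond H(u)$ be a connected non-odd-bipartite $k$-uniform hypergraph, where $H$ is odd-bipartite. Then $\lambda_{\min}(G)\le \dfrac{k\,\varepsilon(G_0)}{\nu(G)}$.
   Context: A $k$-uniform hypergraph $G=(V(G),E(G))$ has every edge a $k$-subset of $V(G)$; $\nu(G)=|V(G)|$, $\varepsilon(G)=|E(G)|$, $d(v)$ is the number of edges containing $v$; connectedness via walks. For $x\in\mathbb{R}^{V(G)}$, $x^e=\prod_{v\in e}x_v$, $x_e^k=\sum_{v\in e}x_v^k$. The signless Laplacian tensor $\mathcal{Q}(G)=\mathcal{D}(G)+\mathcal{A}(G)$, with $\mathcal{D}(G)$ diagonal with entries $d(v)$ and $\mathcal{A}(G)$ having entry $1/(k-1)!$ at $(i_1,\dots,i_k)$ iff $\{v_{i_1},\dots,v_{i_k}\}\in E(G)$. $\lambda_{\min}(G)$ is the least H-eigenvalue of $\mathcal{Q}(G)$ (least real $\lambda$ with a nonzero real $x$ satisfying $(\lambda-d(v))x_v^{k-1}=\sum_{e\ni v}x^{e\setminus\{v\}}$ for all $v$); for even $k$ it equals $\min\{\sum_{e\in E(G)}(x_e^k+kx^e):\sum_v|x_v|^k=1\}$. $G$ is odd-bipartite if some bipartition $\{V_1,V_2\}$ of $V(G)$ has every edge meeting $V_1$ in an odd number of vertices; otherwise non-odd-bipartite. The coalescence $G_0(u)\diamond H(u)$ is obtained from vertex-disjoint $G_0,H$ by identifying a vertex of $G_0$ with a vertex of $H$ into the new vertex $u$. *)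

(* Defs.v *)
From HB Require Import structures.
From mathcomp Require Import all_boot all_order all_algebra.
From mathcomp Require Import reals.

Set Implicit Arguments.
Unset Strict Implicit.
Unset Printing Implicit Defensive.

Import Order.TTheory GRing.Theory Num.Theory.
Local Open Scope ring_scope.

Record hypergraph := Hypergraph {
  vertex :> finType;
  edges : {set {set vertex}}
}.

Definition nu (G : hypergraph) : nat := #|G|.
Definition eps (G : hypergraph) : nat := #|edges G|.

Definition uniform (k : nat) (G : hypergraph) : bool :=
  [forall e in edges G, #|e| == k].

Definition degree (G : hypergraph) (v : G) : nat :=
  #|[set e in edges G | v \in e]|.

Definition adjacent (G : hypergraph) : rel G :=
  [rel v w | [exists e in edges G, (v \in e) && (w \in e)]].

(* A walk is a path for [adjacent]: consecutive vertices share an edge. *)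
Definition hconnected (G : hypergraph) : bool :=
  [forall v, forall w, connect (@adjacent G) v w].

(* The bipartition is {V1, ~: V1}.  No part is required to be nonempty: when k
   is even and there is an edge this is automatic, and an edgeless hypergraph
   counts as odd-bipartite. *)
Definition odd_bipartite (G : hypergraph) : bool :=
  [exists V1 : {set G}, [forall e in edges G, odd #|e :&: V1|]].

Section Coalescence.
Variables (G0 H : hypergraph) (u0 : G0) (u1 : H).

(* Disjoint union of the two vertex sets with u1 glued onto u0: the glued
   vertex u is [inl u0]. *)
Definition coal_vertex : finType := (G0 + {v : H | v != u1})%type.

Definition coal_inl (v : G0) : coal_vertex := inl v.

Definition coal_inr (v : H) : coal_vertex :=
  if insub v is Some v' then inr v' else inl u0.

Definition coalescence : hypergraph :=
  @Hypergraph coal_vertex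
    ([set coal_inl @: (e : {set G0}) | e in edges G0] :|:
     [set coal_inr @: (e : {set H}) | e in edges H]).

End Coalescence.

Section Tensor.
Variables (R : realType) (k : nat).

(* Real tensors of order k whose indices range over V. *)
Definition tensor (V : finType) := {ffun k.-tuple V -> R}.

(* (T x^{k-1})_i = \sum_(i_2, ..., i_k) T_{i i_2 ... i_k} x_{i_2} ... x_{i_k} *)
Definition tensor_apply (V : finType) (T : tensor V) (x : {ffun V -> R})
    (i : V) : R :=
  \sum_(t : k.-tuple V | ohead t == Some i) T t * \prod_(j <- behead t) x j.

Definition H_eigenvalue (V : finType) (T : tensor V) (lam : R) : Prop :=
  exists2 x : {ffun V -> R},
    x != 0 & forall i, tensor_apply T x i = lam * x i ^+ k.-1.

Definition degree_entry (G : hypergraph) (t : k.-tuple G) : R :=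
  if tval t is v :: _ then if constant t then (degree v)%:R else 0 else 0.

Definition adjacency_entry (G : hypergraph) (t : k.-tuple G) : R :=
  if [set v in t] \in edges G then ((k.-1)`!)%:R^-1 else 0.

Definition degree_tensor (G : hypergraph) : tensor G :=
  finfun (@degree_entry G).

Definition adjacency_tensor (G : hypergraph) : tensor G :=
  finfun (@adjacency_entry G).

Definition signless_laplacian (G : hypergraph) : tensor G :=
  degree_tensor G + adjacency_tensor G.

Definition is_lambda_min (G : hypergraph) (lam : R) : Prop :=
  H_eigenvalue (signless_laplacian G) lam /\
  forall mu : R, H_eigenvalue (signless_laplacian G) mu -> lam <= mu.

End Tensor.

(* Main.v *)
Require Import Defs.
From HB Require Import structures.
From mathcomp Require Import all_boot all_order all_algebra.
From mathcomp Require Import reals.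
From mathcomp Require Import all_classical all_analysis.
From mathcomp Require Import ring lra.

(** For even k, lambda_min is the minimum of the form sum_e (x_e^k + k x^e) on
    the sphere sum_v x_v^k = 1: a minimizer exists by compactness and is
    critical in each coordinate, hence an H-eigenvector, and Euler's identity
    shows that every H-eigenvalue is a value of the form on that sphere.  For
    the upper bound, evaluate the form at a sign vector.  The odd bipartition of
    H gives signs making every edge of H contribute zero, and since k is even
    this survives a global flip of H, so H can be matched at u with any sign
    vector on G_0.  Averaged over all sign vectors of G_0 the sum of the x^e
    vanishes, so some choice makes the edges of G_0 contribute at most
    k eps(G_0). *)

Set Implicit Arguments.
Unset Strict Implicit.
Unset Printing Implicit Defensive.

Import Order.TTheory GRing.Theory Num.Theory.
Import numFieldNormedType.Exports.
Local Open Scope ring_scope.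

(** * The signless Laplacian tensor and its form *)

Section SignlessForm.
Variable R : realType.

Lemma tensor_applyE (V : finType) n (T : tensor R n.+1 V) (x : {ffun V -> R})
    (i : V) :
  tensor_apply T x i =
  \sum_(s : n.-tuple V) T [tuple of i :: s] * \prod_(j <- s) x j.
Proof.
rewrite /tensor_apply.
rewrite (reindex_onto (fun s : n.-tuple V => [tuple of i :: s])
                      (fun t : n.+1.-tuple V => [tuple of behead t])) /=.
  by apply: eq_bigl => s; rewrite eqxx /=; apply/eqP/val_inj.
by move=> t; case/tupleP: t => a s /= /eqP[->]; apply: val_inj.
Qed.

Lemma degree_tensor_apply n (G : hypergraph) (x : {ffun G -> R}) (i : G) :
  tensor_apply (degree_tensor R n.+1 G) x i = (degree i)%:R * x i ^+ n.
Proof.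
rewrite tensor_applyE (bigD1 [tuple of nseq n i]) //=.
rewrite [X in _ + X]big1 => [|s nsi].
  by rewrite addr0 ffunE /degree_entry /= all_pred1_nseq /= ?eqxx ?orbT
    big_nseq iter_mulr_1.
rewrite ffunE /degree_entry /=; case: ifP; rewrite ?mul0r // => /all_pred1P sE.
by case/eqP: nsi; apply: val_inj; rewrite /= sE size_tuple.
Qed.

(** Puts the tuples that contribute to an edge [e] in the shape counted by [card_uniq_tuples].
    Covering the [n.+1] vertices of [e] by [i] and [n] entries leaves no room for a repetition or
    for [i] among the entries. *)
Lemma setU1_tuple_eq (V : finType) n (i : V) (e : {set V}) (s : n.-tuple V) :
  i \in e -> #|e| = n.+1 ->
  (i |: [set v in s] == e) = all (mem (e :\ i)) s && uniq s.
Proof.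
move=> ie ce; apply/eqP/andP => [eE | [/allP se us]].
  have /card_uniqP/andP[nis us] : #|i :: s| = size (i :: s).
    by rewrite /= size_tuple -ce -eE; apply: eq_card => v; rewrite !inE.
  split=> //; apply/allP => v vs /=.
  by rewrite !inE -eE !inE vs orbT andbT; apply: contraNneq nis => <-.
apply/eqP; rewrite eqEcard; apply/andP; split.
  apply/fintype.subsetP => v; rewrite !inE => /predU1P[-> // | /se] /=.
  by rewrite !inE => /andP[].
rewrite ce cardsU1 cardsE (card_uniqP us) size_tuple inE.
by have -> : i \notin s by apply/negP => /se; rewrite !inE eqxx.
Qed.

(** For each edge [e] through [i], the contributing tuples are the [n]! orderings of [e :\ i]. All
    carry the same monomial, so their number cancels the coefficient of the tensor. *)
Lemma adjacency_tensor_apply n (G : hypergraph) (x : {ffun G -> R}) (i : G) :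
  uniform n.+1 G ->
  tensor_apply (adjacency_tensor R n.+1 G) x i =
  \sum_(e in edges G | i \in e) \prod_(v in e | v != i) x v.
Proof.
move=> /forall_inP uG; rewrite tensor_applyE.
under eq_bigr => s _.
  rewrite ffunE /adjacency_entry /= set_cons (fun_if (fun c => c * _)) mul0r.
  over.
rewrite -big_mkcond /=.
rewrite (partition_big (fun s : n.-tuple G => i |: [set v in s])
  (fun e => (e \in edges G) && (i \in e))) /= => [|s ->]; last exact: setU11.
apply: eq_bigr => e /andP[eG ie].
have ce : #|e| = n.+1 by apply/eqP/uG.
have cei : #|e :\ i| = n by apply/eqP; rewrite -eqSS -ce (cardsD1 i e) ie.
under eq_bigl => s.
  rewrite (_ : _ && _ = all (mem (e :\ i)) s && uniq s); last first.
    rewrite -setU1_tuple_eq //; apply/andb_idl => /eqP ->; exact: eG.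
  over.
transitivity (\sum_(s : n.-tuple G | all (mem (e :\ i)) s && uniq s)
                (n`!)%:R^-1 * \prod_(v in e | v != i) x v).
  apply: eq_bigr => s /andP[/allP se us]; congr (_ * _).
  have sE : s =i e :\ i.
    apply/subset_cardP; last by apply/fintype.subsetP.
    by rewrite (card_uniqP us) size_tuple cei.
  rewrite big_uniq //=; apply: eq_bigl => v.
  by rewrite sE !inE andbC.
rewrite sumr_const (_ : #|_| = n`!%N); last first.
  have := card_uniq_tuples n (mem (e :\ i)); rewrite cei ffactnn => <-.
  by apply: eq_card => s; rewrite !inE.
by rewrite -mulrnAl -mulr_natl mulfV ?mul1r // pnatr_eq0 -lt0n fact_gt0.
Qed.

Lemma signless_laplacian_apply n (G : hypergraph) (x : {ffun G -> R}) (i : G) :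
  uniform n.+1 G ->
  tensor_apply (signless_laplacian R n.+1 G) x i =
  (degree i)%:R * x i ^+ n +
  \sum_(e in edges G | i \in e) \prod_(v in e | v != i) x v.
Proof.
move=> uG; rewrite -(@degree_tensor_apply n) -(@adjacency_tensor_apply n) //.
rewrite /tensor_apply.
by rewrite -big_split; apply: eq_bigr => t _; rewrite ffunE mulrDl.
Qed.

Definition signless_form k (G : hypergraph) (x : G -> R) : R :=
  \sum_(e in edges G)
    (\sum_(v in e) x v ^+ k + k%:R * \prod_(v in e) x v).

Lemma sum_degreeM (G : hypergraph) (a : G -> R) :
  \sum_v (degree v)%:R * a v = \sum_(e in edges G) \sum_(v in e) a v.
Proof.
rewrite [RHS](exchange_big_dep predT) //=; apply: eq_bigr => v _.
rewrite sumr_const mulr_natl; congr (_ *+ _).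
by apply: eq_card => e; rewrite !inE.
Qed.

(** Multiplying row [i] by [x i] completes each monomial to the full edge product, which then occurs
    once per vertex of the edge; this is the factor [k] in the form. *)
Lemma signless_form_Euler n (G : hypergraph) (x : {ffun G -> R}) :
  uniform n.+1 G ->
  \sum_i x i * tensor_apply (signless_laplacian R n.+1 G) x i =
  signless_form n.+1 x.
Proof.
move=> uG; under eq_bigr => i _ do
  rewrite signless_laplacian_apply // mulrDr mulrCA -exprS.
rewrite big_split /signless_form [RHS]big_split /=; congr (_ + _).
  exact: (sum_degreeM (fun i => x i ^+ n.+1)).
under eq_bigr => i _ do rewrite mulr_sumr.
rewrite (exchange_big_dep (mem (edges G))) => [|i e _ /andP[]] //=.
apply: eq_bigr => e eG.
rewrite (eq_bigl (mem e)) => [|i]; last by rewrite eG.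
rewrite (eq_bigr (fun=> \prod_(v in e) x v)) => [|i ie].
  by rewrite sumr_const mulr_natl (eqP (forall_inP uG e eG)).
by rewrite [RHS](bigD1 i).
Qed.

(** Only edges through [i] change, and each is a pure power plus a linear term in the coordinate
    [i]. Criticality thus becomes a one-variable question. *)
Lemma signless_form_coord n (G : hypergraph) (x y : G -> R) (i : G) :
  (forall v, v != i -> y v = x v) ->
  signless_form n.+1 y - signless_form n.+1 x =
  (degree i)%:R * (y i ^+ n.+1 - x i ^+ n.+1) +
  (n.+1)%:R * (y i - x i) *
    \sum_(e in edges G | i \in e) \prod_(v in e | v != i) x v.
Proof.
move=> yx; rewrite /signless_form -sumrB.
rewrite (bigID (fun e : {set G} => i \in e)) /=.
rewrite [X in _ + X]big1 ?addr0 => [|e /andP[_ nie]]; last first.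
  have yxe v : v \in e -> y v = x v.
    by move=> ve; apply: yx; apply: contraNneq nie => <-.
  rewrite (eq_bigr _ (fun v ve => congr1 (fun a => a ^+ _) (yxe v ve))).
  by rewrite (eq_bigr _ yxe) subrr.
(* The degree is spread out as a sum over the edges through [i], so that both sides compare edge by
   edge. *)
rewrite mulr_sumr mulr_natl -sumr_const.
under [X in _ = X + _]eq_bigl => e do rewrite inE.
rewrite -big_split; apply: eq_bigr => e /andP[_ ie].
rewrite [\sum_(v in e) y v ^+ _](bigD1 i) //.
rewrite [\sum_(v in e) x v ^+ _](bigD1 i) //=.
rewrite [\prod_(v in e) y v](bigD1 i) // [\prod_(v in e) x v](bigD1 i) //=.
rewrite [\sum_(_ in e | _) y _ ^+ _](eq_bigr (fun v => x v ^+ n.+1));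
  last by move=> v /andP[_ /yx->].
rewrite [\prod_(_ in e | _) y _](eq_bigr x) => [|v /andP[_ /yx->]] //.
ring.
Qed.
End SignlessForm.

(** * Minimizers of homogeneous functions on the sphere *)

Section Minimum.
Local Open Scope classical_set_scope.
Variable R : realType.

Lemma monomial_linear_critical_point n (a b x : R) :
  (forall t, a * x ^+ n.+1 + b * x <= a * t ^+ n.+1 + b * t) ->
  n.+1%:R * a * x ^+ n + b = 0.
Proof.
move=> xmin; pose f (t : R) := a * t ^+ n.+1 + b * t.
have df (t : R) : is_derive t 1 f (n.+1%:R * a * t ^+ n + b).
  rewrite (_ : f = a \*: (@idfun R ^+ n.+1) + b \*: @idfun R).
    apply: is_derive_eq; rewrite /GRing.scale /= !mulr1.
    by rewrite -mulrA mulrCA.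
  by apply/funext => t'; rewrite /f !fctE.
have fx : is_derive x 1 f 0.
  (* The minimum is global, so any open interval around [x] serves. *)
  apply: (@derive1_at_min R f (x - 1) (x + 1) x).
  - by rewrite lerD2l; lra.
  - by move=> t _; case: (df t).
  - by rewrite in_itv /= ltrBlDr ltrDl ltr01.
  - by move=> t _; apply: xmin.
by have [_ dfx] := df x; have [_ fx0] := fx; exact: etrans (esym dfx) fx0.
Qed.

(** A minimizer exists on the compact sphere, and homogeneity carries its inequality to every [y] by
    rescaling. The vertex [v0] makes the sphere nonempty. *)
Lemma homogeneous_min (V : finType) (v0 : V) k (f : (V -> R) -> R) :
  (0 < k)%N -> ~~ odd k ->
  continuous (f : prod_topology (fun _ : V => R) -> R) ->
  (forall c y, f (fun v => c * y v) = c ^+ k * f y) ->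
  exists2 x : V -> R, \sum_v x v ^+ k = 1 &
    forall y, f x * \sum_v y v ^+ k <= f y.
Proof.
move=> k0 ek cf hf.
have pw_ge0 (a : R) : 0 <= a ^+ k by rewrite exprn_even_ge0.
pose T := prod_topology (fun _ : V => R).
have cX v : continuous (fun x : T => x v).
  exact: (@proj_continuous V (fun=> R)).
pose S := [set x : T | \sum_v x v ^+ k = 1].
have cS : compact S.
  apply: (@subclosed_compact _ _ [set x : T | forall v, `[-1, 1] (x v)]).
  - have := @closed_eq R 1; set A := [set _ | _] => cA.
    rewrite (_ : S = (fun x : T => \sum_v x v ^+ k) @^-1` A) //.
    move: A cA; apply/continuous_closedP.
    apply: continuous_big => [|v _]; first exact: add_continuous.
    move=> x; apply: (@continuous_comp T R R (fun x => x v) (fun a => a ^+ k)).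
      exact: cX.
    exact: exprn_continuous.
  - apply: (@tychonoff V (fun=> R) (fun=> `[-1, 1])) => v.
    exact: segment_compact.
  - move=> x xS v; rewrite /= in_itv /= -ler_norml.
    have : x v ^+ k <= 1 by rewrite -xS (bigD1 v) //= lerDl sumr_ge0.
    by rewrite -(@ger0_norm _ (x v ^+ k)) // normrX expr_le1.
have S0 : S !=set0.
  exists (fun v => (v == v0)%:R).
  rewrite /S /= (bigD1 v0) //= big1 ?eqxx ?expr1n ?addr0 // => v.
  by move/negPf ->; rewrite expr0n -[k]prednK.
have [] := @compact_EVT_min _ _ _ _ S0 cS (continuous_subspaceT cf).
move=> x /set_mem xS xmin; exists x => // y.
set s := \sum_v _; have s0 : 0 <= s by apply: sumr_ge0.
(* The [k]-norm of [y]; dividing by it puts a nonzero [y] on the sphere. *)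
pose r := s `^ (k%:R^-1).
have rk : r ^+ k = s.
  rewrite -powR_mulrn ?powR_ge0 // -powRrM mulVf ?powRr1 //.
  by rewrite pnatr_eq0 -lt0n.
have [s_eq0|sN0] := eqVneq s 0.
  rewrite s_eq0 mulr0.
  suff -> : y = fun v => 0 * y v by rewrite hf expr0n -[k]prednK //= mul0r.
  apply/funext => v; rewrite mul0r.
  have /(_ v isT)/eqP := psumr_eq0P (fun i _ => pw_ge0 (y i)) s_eq0.
  by rewrite expf_eq0 k0 => /eqP.
have rN0 : r != 0.
  by apply: contraNneq sN0 => r0; rewrite -rk r0 expr0n -[k]prednK.
have : f x <= f (fun v => r^-1 * y v).
  apply/xmin/mem_set; rewrite /S /=.
  under eq_bigr do rewrite exprMn.
  by rewrite -mulr_sumr -/s -rk exprVn mulVf // expf_neq0.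
by rewrite hf exprVn rk mulrC ler_pdivlMr // lt_def sN0.
Qed.

Lemma continuous_signless_form k (G : hypergraph) (T : topologicalType)
    (F : G -> T -> R) :
  (forall v, continuous (F v)) ->
  continuous (fun t => signless_form k (F^~ t)).
Proof.
move=> cF; apply: continuous_big => [|e _ t]; first exact: add_continuous.
have cS : continuous (fun t => \sum_(v in e) F v t ^+ k).
  apply: continuous_big => [|v _ y]; first exact: add_continuous.
  apply: (@continuous_comp T R R (F v) (fun a => a ^+ k)); first exact: cF.
  exact: exprn_continuous.
have cP : continuous (fun t => \prod_(v in e) F v t).
  by apply: continuous_big => [|v _]; [exact: mul_continuous | exact: cF].
by apply: cvgD; [exact: cS | apply: cvgM; [exact: cvg_cst | exact: cP]].
Qed.

End Minimum.

(** * The least H-eigenvalue as the minimum of the form *)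

Lemma exists_lambda_min (R : realType) n (G : hypergraph) (v0 : G) :
  odd n -> uniform n.+1 G ->
  exists2 lam : R, is_lambda_min n.+1 G lam &
    forall y : G -> R, lam * \sum_v y v ^+ n.+1 <= signless_form n.+1 y.
Proof.
move=> on uG.
have [] := @homogeneous_min R G v0 n.+1 (@signless_form R n.+1 G) isT.
- by rewrite /= negbK.
- apply: (@continuous_signless_form R n.+1 G (prod_topology (fun _ : G => R))
    (fun v x => x v)) => v.
  exact: (@proj_continuous G (fun=> R)).
- move=> c y; rewrite /signless_form mulr_sumr; apply: eq_bigr => e eG.
  rewrite mulrDr mulr_sumr big_split /= prodr_const.
  rewrite (eqP (forall_inP uG e eG)) mulrCA; congr (_ + _).
  by apply: eq_bigr => v _; rewrite exprMn.
move=> x x1 xmin; exists (signless_form n.+1 x) => //.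
set lam := signless_form _ _.
split=> [|mu [y yN0 ymu]].
  exists (finfun x).
    apply/eqP => x0; have /eqP := x1; rewrite big1 ?(eq_sym 0) ?oner_eq0 // => v _.
    by have /ffunP/(_ v) := x0; rewrite !ffunE => ->; rewrite expr0n.
  move=> i; rewrite signless_laplacian_apply // ffunE.
  set L := \sum_(e in _ | _) _.
  (* [xmin] holds off the sphere too, so the form minus [lam] times the sum of powers is globally
     minimal at [x]. The coordinate [i] can therefore vary freely, without a constraint. *)
  have : n.+1%:R * ((degree i)%:R - lam) * x i ^+ n + n.+1%:R * L = 0.
    apply: monomial_linear_critical_point => t.
    pose y v := if v == i then t else x v.
    have yx v : v != i -> y v = x v by rewrite /y => /negPf->.
    have yi : y i = t by rewrite /y eqxx.
    have := signless_form_coord n yx; rewrite yi -/lam.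
    have -> : \sum_(e in edges G | i \in e) \prod_(v in e | v != i) x v = L.
      by apply: eq_bigr => e _; apply: eq_bigr => v _; rewrite ffunE.
    have := xmin y; rewrite -/lam.
    move: x1; rewrite (bigD1 i) //= [\sum_v y v ^+ _](bigD1 i) //= yi.
    rewrite [\sum_(_ | _) y _ ^+ _](eq_bigr (fun v => x v ^+ n.+1));
      last by move=> v /yx->.
    set S := \sum_(_ | _) _ => /(canRL (addKr _)) -> h1 h2.
    by move: h1; rewrite -[signless_form _ y](subrK lam) h2; lra.
  rewrite -mulrA -mulrDr => /eqP; rewrite mulf_eq0 pnatr_eq0 /= => /eqP.
  by rewrite mulrBl addrAC => /subr0_eq.
(* By Euler's identity the form at the eigenvector [y] is [mu] times the sum of powers, which is
   positive and cancels. *)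
have := xmin y; rewrite -(signless_form_Euler _ uG) -/lam.
under [X in _ <= X -> _]eq_bigr => i _ do rewrite ymu mulrCA -exprS.
rewrite -mulr_sumr ler_pM2r //.
have pw_ge0 (a : R) : 0 <= a ^+ n.+1 by rewrite exprn_even_ge0 //= negbK.
rewrite lt_def sumr_ge0 ?andbT => [|v _ //]; apply: contraNneq yN0 => y0.
apply/eqP/ffunP => v; rewrite ffunE.
have /(_ v isT)/eqP := psumr_eq0P (fun i _ => pw_ge0 (y i)) y0.
by rewrite expf_eq0 => /eqP.
Qed.

(** Summed over all [s], the quantity vanishes, so it cannot be positive for every [s]. *)
Lemma exists_sum_sign_le0 (R : realDomainType) (V : finType)
    (E : {set {set V}}) :
  finset.set0 \notin E ->
  exists s : {ffun V -> bool},
    \sum_(e in E) \prod_(v in e) (-1) ^+ s v <= 0 :> R.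
Proof.
move=> E0; pose F (s : {ffun V -> bool}) : R :=
  \sum_(e in E) \prod_(v in e) (-1) ^+ s v.
have [/existsP // | /existsPn Fpos] := boolP [exists s, F s <= 0].
suff F0 : \sum_s F s = 0.
  have := F0; rewrite (bigD1 [ffun=> true]) //= => /eqP; rewrite gt_eqF //.
  rewrite ltr_wpDr // ?ltNge // sumr_ge0 // => s _.
  by rewrite ltW // ltNge.
rewrite exchange_big big1 //= => e eE.
have [v0 ve] : exists v, v \in e by apply/finset.set0Pn; apply: contraNneq E0 => <-.
under eq_bigr => s _ do rewrite big_mkcond.
(* The sum over [s] factors over the vertices, and the factor at [v0] is -1 + 1. *)
rewrite -(bigA_distr_bigA (fun v (b : bool) => if v \in e then (-1) ^+ b else 1)).
by rewrite (bigD1 v0) //= big_bool ve expr1 expr0 /= addNr mul0r.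
Qed.

(** * Edges of a coalescence *)

Section CoalescenceEmbedding.
Variables (G0 H : hypergraph) (u0 : G0) (u1 : H).

Lemma coal_inl_inj : injective (@coal_inl G0 H u1).
Proof. by move=> v w []. Qed.

Lemma coal_inr_inj : injective (@coal_inr G0 H u0 u1).
Proof.
move=> v w; rewrite /coal_inr.
case: insubP => [v' _ <-|/negPn/eqP->]; case: insubP => [w' _ <-|/negPn/eqP->] //.
by case=> ->.
Qed.

Lemma uniform_coalescence k :
  uniform k (coalescence u0 u1) -> uniform k G0 /\ uniform k H.
Proof.
move=> /forall_inP uG; split; apply/forall_inP => e eE.
  rewrite -(card_imset _ coal_inl_inj); apply: uG.
  by rewrite inE imset_f.
rewrite -(card_imset _ coal_inr_inj); apply: uG.
by rewrite inE orbC imset_f.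
Qed.

(** Splitting by membership in the image of [edges G0] leaves only images of edges of [H], where [F]
    vanishes; an edge in both images is counted once, on the side of [G0]. *)
Lemma sum_edges_coalescence (R : nmodType) (F : {set coalescence u0 u1} -> R) :
  (forall e, e \in edges H -> F (coal_inr u0 u1 @: (e : {set H})) = 0) ->
  \sum_(e in edges (coalescence u0 u1)) F e =
  \sum_(e in edges G0) F (coal_inl u1 @: (e : {set G0})).
Proof.
move=> FH; rewrite -(big_imset _ (in2W (imset_inj coal_inl_inj))) /=.
rewrite (bigID (mem [set coal_inl u1 @: (e : {set G0}) | e in edges G0])) /=.
rewrite [X in _ + X]big1 ?addr0 => [|e /andP[]]; last first.
  by rewrite inE => /orP[-> // |/imsetP[f fH ->] _]; apply: FH.
apply: eq_bigl => e; rewrite inE andb_orl andbb.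
by apply/orb_idr => /andP[].
Qed.

End CoalescenceEmbedding.

(** * Evaluation at a sign vector *)

Theorem theorem5p2 (R : realType) (k : nat) (hk : (1 < k)%N) (hkeven : ~~ odd k)
    (G0 H : hypergraph) (u0 : G0) (u1 : H)
    (hunif : uniform k (coalescence u0 u1))
    (hconn : hconnected (coalescence u0 u1))
    (hGnob : ~~ odd_bipartite (coalescence u0 u1))
    (hHob : odd_bipartite H) :
  exists2 lam : R, is_lambda_min k (coalescence u0 u1) lam &
    lam <= (k%:R * (eps G0)%:R) / (nu (coalescence u0 u1))%:R.
Proof.
case: k hk hkeven hunif => // n _; rewrite /= negbK => on uG.
have [uG0 uH] := uniform_coalescence uG.
have [lam lamP lam_le] := @exists_lambda_min R n _ (inl u0 : coalescence u0 u1) on uG.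
exists lam => //.
have nset0 : finset.set0 \notin edges G0.
  by apply/negP => /(forall_inP uG0); rewrite cards0.
have [s s_le0] := exists_sum_sign_le0 R nset0.
have /existsP[V1 /forall_inP V1odd] := hHob.
pose tau (v : H) : R := (-1) ^+ (v \in V1).
(* The global flip of [H], chosen so that [c * tau u1] is the sign already given to [u0]. *)
pose c : R := (-1) ^+ s u0 * tau u1.
pose y (w : coalescence u0 u1) : R :=
  match w with inl v => (-1) ^+ s v | inr v => c * tau (val v) end.
have even_sign (b : bool) : ((-1) ^+ b) ^+ n.+1 = 1 :> R.
  by rewrite exprAC -signr_odd /= on expr1n.
have c1 : c ^+ n.+1 = 1 by rewrite exprMn !even_sign mulr1.
have y1 w : y w ^+ n.+1 = 1.
  by case: w => v; rewrite /= ?exprMn ?c1 ?even_sign ?mulr1.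
have y_inr (v : H) : y (coal_inr u0 u1 v) = c * tau v.
  rewrite /coal_inr; case: insubP => [w _ <-|/negPn/eqP->] //=.
  by rewrite /c -mulrA -expr2 sqrr_sign mulr1.
rewrite ler_pdivlMr; last by rewrite ltr0n; apply/card_gt0P; exists (inl u0).
(* All [k]-th powers of [y] are 1, so their sum is the number of vertices. *)
have := lam_le y; rewrite (eq_bigr (fun=> 1)) => [|w _]; last exact: y1.
rewrite sumr_const => /le_trans; apply.
have -> : signless_form n.+1 y =
    \sum_(e in edges (coalescence u0 u1)) n.+1%:R * (1 + \prod_(v in e) y v).
  apply: eq_bigr => e eG.
  rewrite [\sum_(v in e) _](eq_bigr (fun=> 1)) => [|w _]; last exact: y1.
  by rewrite sumr_const (eqP (forall_inP uG e eG)) mulrDr mulr1.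
(* On an edge of [H] the flip contributes [c ^+ n.+1], which is 1, and the odd intersection with
   [V1] gives the product -1, cancelling the 1. *)
rewrite sum_edges_coalescence => [|e eH]; last first.
  rewrite big_imset /= => [|v w _ _]; last exact: coal_inr_inj.
  under eq_bigr do rewrite y_inr.
  rewrite big_split /= prodr_const (eqP (forall_inP uH e eH)) c1 mul1r.
  rewrite (_ : \prod_(v in e) tau v = -1) ?subrr ?mulr0 //.
  rewrite prodrXr /=.
  rewrite -signr_odd (_ : (\sum_(v in e) _)%N = #|e :&: V1|) ?V1odd //.
  rewrite -sum1_card; under [RHS]eq_bigl => v do rewrite finset.in_setI.
  by rewrite big_mkcondr; apply: eq_bigr => v _; case: (v \in V1).
(* What remains is [eps G0] plus the sign sum of [s], which is nonpositive by the choice of [s]. *)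
rewrite -mulr_sumr ler_pM2l ?ltr0n // big_split /= sumr_const /eps gerDl.
apply: le_trans s_le0; rewrite le_eqVlt; apply/orP; left; apply/eqP.
apply: eq_bigr => e _; rewrite big_imset //= => v w _ _; exact: coal_inl_inj.
Qed.
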